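(* Let $k\geq 3$ and let $0<\epsilon<16^{-k}$. Then there exists $n_0$ such that for every $k$-uniform hypergraph $G$ on $n>n_0$ vertices with $e(G)>(1-\epsilon)\binom{n}{k}$ we have $\mathrm{mc}_k(G)\geq (1-8\sqrt[k]{\epsilon})n$.
   Context: A hypergraph is connected if its shadow graph (two vertices adjacent iff they lie in a common edge) is connected; a component is a maximal connected subhypergraph, and its order is its number of vertices. For an $r$-coloring $\chi$ of the edges of $H$, $\mathrm{mc}(H,\chi)$ is the largest order of a component of the subhypergraph formed by the edges of a single color, and $\mathrm{mc}_r(H)=\min_\chi \mathrm{mc}(H,\chi)$ over all $r$-colorings $\chi$ of the edges. $e(G)$ is the number of edges. *)

(* Defs.v *)
From HB Require Import structures.
From mathcomp Require Import all_boot all_order all_algebra.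
From mathcomp Require Import reals exp.

Set Implicit Arguments.
Unset Strict Implicit.
Unset Printing Implicit Defensive.

(* The vertices and edges are drawn from an ambient finite type [T], so that
   the subhypergraphs of a hypergraph again live in [hypergraph T]. *)
Record hypergraph (T : finType) := Hypergraph {
  hypergraph_val : {set T} * {set {set T}};
  _ : [forall e in hypergraph_val.2, e \subset hypergraph_val.1]
}.

HB.instance Definition _ (T : finType) := [isSub for @hypergraph_val T].
HB.instance Definition _ (T : finType) := [Countable of hypergraph T by <:].
HB.instance Definition _ (T : finType) := [Finite of hypergraph T by <:].

Section Hypergraphs.
Variable T : finType.
Implicit Types (H C D : hypergraph T) (F : {set {set T}}).

Definition vset H : {set T} := (val H).1.
Definition eset H : {set {set T}} := (val H).2.

Definition horder H : nat := #|vset H|.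

Definition huniform (k : nat) H : bool := [forall e in eset H, #|e| == k].

Definition shadow H : rel T :=
  fun x y => (x != y) && [exists e in eset H, (x \in e) && (y \in e)].

Definition hconnected H : bool :=
  [forall x in vset H, forall y in vset H, connect (shadow H) x y].

Definition subhypergraph C H : bool :=
  (vset C \subset vset H) && (eset C \subset eset H).

Definition hcomponent C H : bool :=
  [&& subhypergraph C H, hconnected C &
    [forall D : hypergraph T,
      [&& subhypergraph D H, hconnected D & subhypergraph C D] ==> (D == C)]].

Lemma spanned_subproof F : [forall e in F, e \subset cover F].
Proof. by apply/forall_inP => e eF; apply: (bigcup_max e). Qed.

Definition spanned F : hypergraph T :=
  @Hypergraph T (cover F, F) (spanned_subproof F).

Definition coloring (r : nat) H := {ffun {e : {set T} | e \in eset H} -> 'I_r}.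

Definition color_class (r : nat) H (chi : coloring r H) (i : 'I_r) :
    hypergraph T :=
  spanned [set val e | e : {e : {set T} | e \in eset H} & chi e == i].

Definition mc (r : nat) H (chi : coloring r H) : nat :=
  \max_(i < r) \max_(C : hypergraph T | hcomponent C (color_class chi i))
    horder C.

(* As [mc chi <= horder H] for every [chi], the default value [horder H] of the
   iterated minimum matters only when [H] has no [r]-coloring. *)
Definition mcr (r : nat) H : nat :=
  \big[minn/horder H]_(chi : coloring r H) mc chi.

End Hypergraphs.

(* Main.v *)
(* Write t = eps^(1/k) and m = 4tn. If some k-coloring has only components of
   order less than (1 - 8t)n, then every color i admits a cut A_i of the vertex
   set which no edge of color i crosses and whose two sides have at least m
   vertices. Count the maps f from the k colors to the vertices whose image is
   crossed by all k cuts. Among the four regions of the first two cuts, two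
   opposite ones have size at least m/2, which gives m^2/4 choices for a pair
   of values crossing both cuts; each remaining cut is crossed by choosing one
   more value on the side opposite to the first one. Hence there are at least
   m^k/4 >= 16 eps n^k such maps. None of them has an edge as its image, while
   all but (eps + O(1/n)) n^k maps enumerate an edge. *)
Require Import Defs.
From HB Require Import structures.
From mathcomp Require Import all_boot all_order all_algebra.
From mathcomp Require Import reals exp.
From mathcomp Require Import lra zify.
Set Implicit Arguments.
Unset Strict Implicit.
Unset Printing Implicit Defensive.

Import Order.TTheory GRing.Theory Num.Theory.
Local Open Scope ring_scope.

(** * Shadow graphs and their components *)

Lemma shadow_sym (T : finType) (H : hypergraph T) : symmetric (shadow H).
Proof.
move=> x y; rewrite /shadow eq_sym; congr (_ && _).
by apply: eq_existsb => e; rewrite [(x \in e) && _]andbC.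
Qed.

Lemma shadow_edge (T : finType) (H : hypergraph T) (e : {set T}) x y :
  e \in eset H -> x \in e -> y \in e -> connect (shadow H) x y.
Proof.
move=> eH xe ye; have [<-|xy] := eqVneq x y; first exact: connect0.
by apply: connect1; rewrite /shadow xy; apply/exists_inP; exists e; rewrite ?xe.
Qed.

Lemma closed_edge (T : finType) (H : hypergraph T) (A e : {set T}) x y :
  closed (shadow H) A -> e \in eset H -> x \in e -> y \in e ->
  (x \in A) = (y \in A).
Proof.
by move=> clA eH xe ye; apply: (closed_connect clA (shadow_edge eH xe ye)).
Qed.

Lemma edge_sub_vset (T : finType) (H : hypergraph T) (e : {set T}) :
  e \in eset H -> e \subset vset H.
Proof. by case: H => p sp /= eH; apply: (forall_inP sp). Qed.

Lemma closed_vset (T : finType) (H : hypergraph T) :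
  closed (shadow H) (vset H).
Proof.
move=> x y /andP[_ /exists_inP[e eH /andP[xe ye]]].
by rewrite !(subsetP (edge_sub_vset eH)).
Qed.

Lemma sub_shadow (T : finType) (C H : hypergraph T) :
  subhypergraph C H -> subrel (shadow C) (shadow H).
Proof.
move=> /andP[_ /subsetP sE] x y /andP[xy /exists_inP[e eC exy]].
by rewrite /shadow xy; apply/exists_inP; exists e => //; apply: sE.
Qed.

(** The component takes all edges of [H] inside the reachability class of [x]. Every edge used by a
    path from [x] lies in that class, so connectivity survives the restriction. A connected [D]
    above it contains [x], hence stays inside the class and gains neither vertices nor edges. *)
Lemma shadow_component (T : finType) (H : hypergraph T) (x : T) :
  x \in vset H -> exists2 C : hypergraph T, hcomponent C H &
    vset C = [set y | connect (shadow H) x y].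
Proof.
move=> xH; set X := [set y | _].
pose E := [set e in eset H | e \subset X].
have sE : [forall e in E, e \subset X].
  by apply/forall_inP => e; rewrite inE => /andP[].
pose C : hypergraph T := @Hypergraph T (X, E) sE.
have sXV : X \subset vset H.
  apply/subsetP => y; rewrite inE => xy.
  by rewrite -(closed_connect (@closed_vset T H) xy).
have CH : subhypergraph C H.
  by rewrite /subhypergraph sXV; apply/subsetP => e; rewrite inE => /andP[].
have xC p : path (shadow H) x p -> connect (shadow C) x (last x p).
  elim/last_ind: p => [|p v IHp]; first by rewrite connect0.
  rewrite rcons_path last_rcons => /andP[pp /[dup] uv].
  move=> /andP[n_uv /exists_inP[e eH /andP[ue ve]]].
  apply: connect_trans (IHp pp) (connect1 _).
  rewrite /shadow n_uv; apply/exists_inP; exists e; rewrite ?ue //= inE eH.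
  apply/subsetP => w we; rewrite inE.
  apply: connect_trans (shadow_edge eH ue we).
  by apply/connectP; exists p.
have csymC := sym_connect_sym (shadow_sym C).
exists C => //; rewrite /hcomponent CH /=; apply/andP; split.
  apply/forall_inP => y; rewrite inE => /connectP[p pp ->].
  apply/forall_inP => z; rewrite inE => /connectP[q pq ->].
  by apply: connect_trans (xC q pq); rewrite csymC xC.
apply/forallP => D; apply/implyP => /and3P[DH Dconn /andP[vCD eCD]].
have xX : x \in X by rewrite inE.
have sDX : vset D \subset X.
  apply/subsetP => y yD; rewrite inE.
  apply: connect_sub (fun u v uv => connect1 (sub_shadow DH uv)) _ _ _.
  by have /forall_inP/(_ y yD) := forall_inP Dconn x (subsetP vCD x xX).
have vD : vset D = X by apply/eqP; rewrite eqEsubset sDX.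
have eD : eset D = E.
  apply/eqP; rewrite eqEsubset eCD andbT; apply/subsetP => e eD.
  rewrite inE -vD (edge_sub_vset eD) andbT.
  by have /andP[_ /subsetP] := DH; apply.
apply/eqP/val_inj; have -> : val C = (vset D, eset D) by rewrite vD eD.
exact: surjective_pairing.
Qed.

(** * Cuts of the vertex set *)

(** A class of size at least [m] is itself such a cut. If all classes are smaller, take a smallest
    closed [A] with at least [m] elements: removing one class leaves fewer than [m], so [A] has
    fewer than [2 * m] and its complement more than [m]. *)
Lemma closed_split (R : realDomainType) (T : finType) (e : rel T)
    (V : {set T}) (m : R) :
  connect_sym e -> closed e V -> 0 < m -> 3 * m <= #|V|%:R ->
  (forall x, x \in V -> #|[set y | connect e x y]|%:R + m <= #|V|%:R) ->
  exists A : {set T}, [/\ A \subset V, closed e A, m <= #|A|%:R &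
    m <= #|V :\: A|%:R].
Proof.
move=> esym clV m_gt0 m3 class_le.
have clX x : closed e [set y | connect e x y].
  by move=> y z yz; rewrite !inE; apply: (connect_closed esym x yz).
have sX x : x \in V -> [set y | connect e x y] \subset V.
  by move=> xV; apply/subsetP => y; rewrite inE => /(closed_connect clV) <-.
have cardD (A : {set T}) : A \subset V -> #|V|%:R = #|A|%:R + #|V :\: A|%:R :> R.
  by move=> /setIidPr sA; rewrite -natrD -(cardsID A V) sA.
case: (pickP [pred x in V | m <= #|[set y | connect e x y]|%:R]) => [x|small].
  move=> /andP[/= xV mx]; exists [set y | connect e x y]; split; rewrite ?sX //.
  by have := class_le x xV; rewrite (cardD _ (sX x xV)); lra.
pose P (A : {set T}) :=
  [&& A \subset V, [forall x, forall y, e x y ==> ((x \in A) == (y \in A))]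
    & m <= #|A|%:R].
have PP (A : {set T}) : reflect [/\ A \subset V, closed e A & m <= #|A|%:R] (P A).
  apply: (iffP and3P) => [] [sA clA mA]; split=> //.
    by move=> x y xy; apply/eqP; apply: (implyP (forallP (forallP clA x) y)).
  by apply/forallP => x; apply/forallP => y; apply/implyP => /clA /eqP.
have PV : P V by apply/PP; split => //; lra.
have [A /PP[sA clA mA] minA] := arg_minnP (fun A : {set T} => #|A|) PV.
exists A; split => //.
have [x xA] : exists x, x \in A.
  apply/set0Pn/eqP => A0; move: mA; rewrite A0 cards0; lra.
have xV := subsetP sA x xA.
set X := [set y | connect e x y] in small *.
have sXA : X \subset A.
  by apply/subsetP => y; rewrite inE => /(closed_connect clA) <-.
have AD : #|A|%:R = #|X|%:R + #|A :\: X|%:R :> R.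
  by rewrite -natrD -(cardsID X A) (setIidPr sXA).
have X_lt : #|X|%:R < m.
  by have := small x; rewrite /= xV /= => /negbT; rewrite -ltNge.
have AX_lt : #|A :\: X|%:R < m.
  rewrite ltNge; apply/negP => mAX.
  have /minA : P (A :\: X).
    apply/PP; split=> //; first exact: subset_trans (subsetDl _ _) sA.
    by move=> y z yz; rewrite !in_setD (clA _ _ yz) (clX x _ _ yz).
  rewrite leqNgt => /negP; apply; apply: proper_card.
  rewrite properEneq subsetDl andbT; apply/eqP => /setP/(_ x).
  by rewrite !inE xA connect0.
by have := cardD A sA; lra.
Qed.

(* The four regions of two cuts form a 2x2 table with all line sums at least
   [m], so one of the two diagonals has both entries at least [m / 2]. *)
Lemma cross_rectangle (R : realFieldType) (T : finType) (V A B : {set T})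
    (m : R) :
  m <= #|V :&: A|%:R -> m <= #|V :\: A|%:R ->
  m <= #|V :&: B|%:R -> m <= #|V :\: B|%:R ->
  exists X Y : {set T}, [/\ X \subset V, Y \subset V,
    m / 2 <= #|X|%:R, m / 2 <= #|Y|%:R &
    forall x y, x \in X -> y \in Y ->
      (x \in A) != (y \in A) /\ (x \in B) != (y \in B)].
Proof.
rewrite -(cardsID B (V :&: A)) -(cardsID B (V :\: A)).
rewrite -(cardsID A (V :&: B)) -(cardsID A (V :\: B)) !natrD.
have -> : V :&: B :&: A = V :&: A :&: B by rewrite setIAC.
have -> : V :&: B :\: A = (V :\: A) :&: B by rewrite setIDAC.
have -> : (V :\: B) :&: A = V :&: A :\: B by rewrite -setIDAC.
have -> : V :\: B :\: A = V :\: A :\: B by rewrite !setDDl setUC.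
have diag (a b c d : R) : m <= a + b -> m <= c + d -> m <= a + c ->
    m <= b + d -> (m / 2 <= a /\ m / 2 <= d) \/ (m / 2 <= b /\ m / 2 <= c).
  move=> *; have [?|?] := leP (m / 2) a; last by right; lra.
  by have [?|?] := leP (m / 2) d; [left | right; lra].
move=> h1 h2 h3 h4; have [[ha hd]|[hb hc]] := diag _ _ _ _ h1 h2 h3 h4.
  exists (V :&: A :&: B), (V :\: A :\: B); split; [| |exact: ha|exact: hd|].
  - by rewrite -setIA subsetIl.
  - by rewrite setDDl subsetDl.
  - move=> x y; rewrite !inE => /andP[/andP[_ ->] ->].
    by move=> /and3P[/negPf-> /negPf-> _].
exists (V :&: A :\: B), ((V :\: A) :&: B); split; [| |exact: hb|exact: hc|].
- exact: subset_trans (subsetDl _ _) (subsetIl _ _).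
- by rewrite setIDAC (subset_trans (subsetDl _ _)) ?subsetIl.
- move=> x y; rewrite !inE => /and3P[/negPf-> _ ->].
  by move=> /andP[/andP[/negPf-> _] ->].
Qed.

(** * Counting maps from the colors to the vertices *)

(** At most a share [k ^ 2 / n] of all maps is not injective, stated without division or
    subtraction. Passing from [k] to [k.+1] loses a further [k / n], and [k ^ 2 + k <= k.+1 ^ 2]. *)
Lemma expn_le_ffact n k : (n ^ k.+1 <= n * n ^_ k + k ^ 2 * n ^ k)%N.
Proof.
elim: k => [|k IHk]; first by rewrite ffactn0 expn1 muln1 leq_addr.
have le_ff : (n ^_ k <= n ^ k)%N.
  by elim: k {IHk} => // k IH; rewrite ffactnSr expnSr leq_mul ?leq_subr.
have step : (n * n ^_ k <= n ^_ k.+1 + k * n ^ k)%N.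
  rewrite ffactnSr mulnC (leq_trans _ (leq_add (leqnn _) (leq_mul (leqnn k) le_ff))) //.
  by rewrite [(k * _)%N]mulnC -mulnDr leq_mul // addnC -leq_subLR.
have := leq_mul (leqnn n) IHk; have := leq_mul (leqnn n) step.
by rewrite !expnS !expn0; nia.
Qed.

(* Choose [f i0] in [X] and [f i1] in [Y], where [X * Y] is separated by the two
   cuts of indices [i0] and [i1], then any other [f i] on the side of the cut of
   index [i] opposite to [f i0]. *)
Lemma card_separated (R : realFieldType) (T I : finType) (V : {set T})
    (A : I -> {set T}) (m : R) (i0 i1 : I) :
  i0 != i1 -> 0 <= m ->
  (forall i, m <= #|V :&: A i|%:R) -> (forall i, m <= #|V :\: A i|%:R) ->
  m ^+ #|I| / 4 <= #|[set f : {ffun I -> T} in ffun_on (mem V) |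
    [forall i, exists u, exists v, (f u \in A i) != (f v \in A i)]]|%:R.
Proof.
move=> i01 m_ge0 mA mA'; set S := [set f in _ | _].
have [X [Y [sX sY mX mY XY]]] :=
  cross_rectangle (mA i0) (mA' i0) (mA i1) (mA' i1).
pose F x i : {set T} := if i == i0 then [set x] else if i == i1 then Y else
  if x \in A i then V :\: A i else V :&: A i.
(* Maps are sorted by their value [x] at [i0]; once [x] is fixed, the admissible values at the
   indices are independent and the count is a product. *)
have S_ge : (\sum_(x in X) \prod_i #|F x i| <= #|S|)%N.
  rewrite -sum1_card (partition_big (fun f : {ffun I -> T} => f i0) predT) //=.
  rewrite [leqRHS](bigID (mem X)) /=; apply: leq_trans (leq_addr _ _).
  apply: leq_sum => x xX; rewrite sum1dep_card.
  have -> : (\prod_i #|F x i| = #|family (fun i => mem (F x i))|)%N.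
    by rewrite card_family foldrE big_map big_enum.
  apply/subset_leq_card/subsetP => f /familyP fF.
  have fx : f i0 = x by have := fF i0; rewrite /= /F eqxx => /set1P.
  have fY : f i1 \in Y.
    by have := fF i1; rewrite /= /F eqxx eq_sym (negPf i01).
  rewrite !inE fx eqxx andbT; apply/andP; split.
    apply/ffun_onP => i; have := fF i; rewrite /= /F.
    case: ifP => [_ /set1P->|_]; first exact: (subsetP sX).
    case: ifP => [_|_]; first exact: (subsetP sY).
    by case: ifP; rewrite inE => _ /andP[].
  apply/forallP => i; apply/existsP; exists i0; apply/existsP.
  have [XY0 XY1] := XY _ _ xX fY.
  have [->|ni0] := eqVneq i i0; first by exists i1; rewrite fx.
  have [->|ni1] := eqVneq i i1; first by exists i1; rewrite fx.
  exists i; have := fF i; rewrite /= /F (negPf ni0) (negPf ni1) fx.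
  by case: ifP => _; rewrite inE => /andP[]; [move=> /negPf-> | move=> _ ->].
pose r := \prod_(i | (i != i0) && (i != i1)) m.
have mE : m ^+ #|I| = m * (m * r).
  by rewrite -prodr_const (bigD1 i0) //= (bigD1 i1) //= eq_sym.
have r_ge0 : 0 <= r by apply: prodr_ge0.
have F_ge x : x \in X -> m / 2 * r <= (\prod_i #|F x i|)%:R.
  move=> xX; rewrite natr_prod (bigD1 i0) //= (bigD1 i1) 1?eq_sym //=.
  rewrite {1}/F eqxx cards1 mul1r.
  apply: ler_pM => //; first by rewrite divr_ge0.
    by rewrite /F eqxx eq_sym (negPf i01).
  apply: ler_prod => i /andP[ni0 ni1]; rewrite m_ge0 /F (negPf ni0) (negPf ni1).
  by case: ifP => _; [exact: mA' | exact: mA].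
apply: le_trans (_ : (m / 2) * (m / 2 * r) <= _); first by rewrite mE; lra.
apply: le_trans (_ : #|X|%:R * (m / 2 * r) <= _).
  by rewrite ler_wpM2r // mulr_ge0 // divr_ge0.
move: S_ge; rewrite -(ler_nat R) => /(le_trans _); apply.
by rewrite natr_sum mulr_natl -sumr_const; apply: ler_sum.
Qed.

Lemma card_ffun_image_notin (T I : finType) (V : {set T}) (E : {set {set T}})
    (S : {set {ffun I -> T}}) :
  (forall e, e \in E -> e \subset V /\ #|e| = #|I|) ->
  (forall f, f \in S -> f \in ffun_on (mem V) /\ f @: I \notin E) ->
  (#|S| + #|I|`! * #|E| <= #|V| ^ #|I|)%N.
Proof.
move=> sE sS; pose Z := [set f : {ffun I -> T} | f @: I \in E].
have Z_ge : (#|I|`! * #|E| <= #|Z|)%N.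
  rewrite -[#|Z|]sum1_card.
  rewrite (partition_big (fun f : {ffun I -> T} => f @: I) (mem E)) /=;
    last by move=> f; rewrite inE.
  rewrite mulnC -sum_nat_const; apply: leq_sum => e eE; have [sV ek] := sE e eE.
  rewrite -ffactnn -{1}ek -card_inj_ffuns_on sum1dep_card.
  apply/subset_leq_card/subsetP => f; rewrite !inE.
  move=> /andP[/ffun_onP fe /injectiveP injf].
  suff -> : f @: I = e by rewrite eE /=.
  apply/eqP; rewrite eqEcard ek card_imset // leqnn andbT.
  by apply/subsetP => _ /imsetP[i _ ->]; apply: fe.
apply: leq_trans (leq_add (leqnn _) Z_ge) _.
rewrite -card_ffun_on -cardsUI.
have -> : S :&: Z = set0.
  apply/setP => f; rewrite !inE; apply/negP => /andP[/sS[_ /negP]]; exact.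
rewrite cards0 addn0; apply/subset_leq_card/subsetP => f; rewrite !inE.
case/orP => [/sS[]//|fE]; apply/ffun_onP => i.
by have [/subsetP sV _] := sE _ fE; apply/sV/imset_f.
Qed.

(** * Color classes and the bound for a single coloring *)

Lemma mc_ge_class (T : finType) (r : nat) (G : hypergraph T)
    (chi : coloring r G) (i : 'I_r) (x : T) :
  x \in vset (color_class chi i) ->
  (#|[set y | connect (shadow (color_class chi i)) x y]| <= mc chi)%N.
Proof.
move=> /shadow_component[C compC <-].
by apply: (bigop.bigmax_sup i) => //; apply: (bigop.bigmax_sup C).
Qed.

Lemma color_class_sub (T : finType) (r : nat) (G : hypergraph T)
    (chi : coloring r G) (i : 'I_r) :
  eset (color_class chi i) \subset eset G.
Proof. by apply/subsetP => e /imsetP[[e' /= e'G] _ ->]. Qed.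

Lemma color_classP (T : finType) (r : nat) (G : hypergraph T)
    (chi : coloring r G) (e : {set T}) :
  e \in eset G -> exists i, e \in eset (color_class chi i).
Proof.
move=> eG; exists (chi (Sub e eG)); apply/imsetP.
by exists (Sub e eG); rewrite ?inE ?SubK.
Qed.

(** Here [t] is the [k]-th root of [eps], and the last hypothesis puts the share [k ^ 2 / n] of
    non-injective maps below [eps]. *)
Lemma mc_almost_complete (R : realFieldType) (T : finType) (k : nat)
    (G : hypergraph T) (chi : coloring k G) (t : R) :
  (3 <= k)%N -> 0 < t -> 16 * t < 1 -> huniform k G ->
  (1 - t ^+ k) * 'C(horder G, k)%:R < #|eset G|%:R ->
  (2 <= horder G)%N -> k%:R ^+ 2 < t ^+ k * (horder G)%:R ->
  (1 - 8 * t) * (horder G)%:R <= (mc chi)%:R.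
Proof.
move=> k3 t0 t1 unifG edges n2 nbig; rewrite leNgt; apply/negP => mc_lt.
rewrite /horder in edges n2 nbig mc_lt; set V := vset G in edges n2 nbig mc_lt.
set N : R := #|V|%:R in edges nbig mc_lt.
have N2 : 2 <= N by rewrite ler_nat.
have tN : 16 * t * N < N by rewrite gtr_pMl //; lra.
have tN0 : 0 < t * N by rewrite mulr_gt0 //; lra.
(* This [m] is within the slack [8 * t * N] left by [mc_lt]; [3 * m < N] since [16 * t < 1]; and
   [k >= 3] makes [m ^+ k / 4] at least [16 * t ^+ k * N ^+ k]. *)
pose m := 4 * t * N.
have m0 : 0 < m by rewrite /m; lra.
have cut i : exists A : {set T},
    [/\ A \subset V, closed (shadow (color_class chi i)) A, m <= #|A|%:R &
      m <= #|V :\: A|%:R].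
  apply: closed_split => //; first exact: sym_connect_sym (@shadow_sym _ _).
  - move=> x y /andP[_ /exists_inP[e /(subsetP (color_class_sub chi i)) eG]].
    by move=> /andP[xe ye]; rewrite !(subsetP (edge_sub_vset eG)).
  - by rewrite -/N /m; lra.
  - move=> x xV; have [xC|xC] := boolP (x \in vset (color_class chi i)).
      have := mc_ge_class xC; rewrite -(ler_nat R); rewrite /m -/N; lra.
    (* A vertex in no edge of color [i] belongs to no component counted by [mc]; its class is a
       singleton, small enough because [N >= 2] and [m < N / 4]. *)
    have -> : [set y | connect (shadow (color_class chi i)) x y] = [set x].
      apply/setP => y; rewrite !inE; apply/idP/eqP => [|->]; last exact: connect0.
      case/connectP => [[|z p] /= pth ->] //; case/andP: pth => /andP[_].
      case/exists_inP => e eC /andP[xe _].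
      by rewrite (subsetP (edge_sub_vset eC)) in xC.
    by rewrite cards1 /m -/N; lra.
have [A cutA] := fin_all_exists cut.
have sepA i : m <= #|V :&: A i|%:R by case: (cutA i) => /setIidPr->.
have sepA' i : m <= #|V :\: A i|%:R by case: (cutA i).
pose i0 := Ordinal (leq_trans (isT : (0 < 3)%N) k3).
pose i1 := Ordinal (leq_trans (isT : (1 < 3)%N) k3).
have := card_separated (isT : i0 != i1) (ltW m0) sepA sepA'.
set S := [set f in _ | _]; rewrite card_ord => S_ge.
have Gk : forall e, e \in eset G -> e \subset V /\ #|e| = #|'I_k|.
  move=> e eG; rewrite card_ord (edge_sub_vset eG); split => //.
  exact/eqP/(forall_inP unifG).
have := card_ffun_image_notin (S := S) Gk; rewrite card_ord => /(_ _)/wrap[].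
  move=> f; rewrite inE => /andP[fV /forallP sepf]; split=> //.
  (* An edge of color [i] lies on one side of the cut [A i], so it cannot be the image of a
     separated map. *)
  apply/negP => /(color_classP chi)[i ei].
  have /existsP[u /existsP[v /negP]] := sepf i; apply; apply/eqP.
  have [_ clA _ _] := cutA i.
  by apply: (closed_edge clA ei); apply: imset_f.
rewrite -(ler_nat R) natrD natrM natrX -/N => S_le.
have := expn_le_ffact #|V| k; rewrite -bin_ffact.
rewrite -(ler_nat R) natrD !natrM !natrX -/N exprS => ff_ge.
have f0 : 0 < k`!%:R :> R by rewrite ltr0n fact_gt0.
have tk0 : 0 < t ^+ k by rewrite exprn_gt0.
have Nk0 : 0 < N ^+ k by rewrite exprn_gt0 //; lra.
have tk1 : t ^+ k <= 1 by rewrite exprn_ile1 //; lra.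
have mk : 16 * (t ^+ k * N ^+ k) <= m ^+ k / 4.
  have e4 : 4 ^+ k = 4 ^+ (k - 3) * 64 :> R.
    by rewrite -{1}(subnK k3) exprD; congr (_ * _); lra.
  have -> : m ^+ k = 4 ^+ (k - 3) * 64 * (t ^+ k * N ^+ k).
    by rewrite /m !exprMn e4 !mulrA.
  have : 1 <= 4 ^+ (k - 3) :> R by rewrite exprn_ege1 // ler1n.
  set q := 4 ^+ _; have := mulr_gt0 tk0 Nk0; set z := _ * N ^+ k; nra.
have edges' : (1 - t ^+ k) * ('C(#|V|, k)%:R * k`!%:R) < #|eset G|%:R * k`!%:R.
  by rewrite mulrA ltr_pM2r.
move: S_ge S_le ff_ge mk edges' nbig tk0 Nk0 tk1 N2.
set s := #|S|%:R; set P := N ^+ k; set ek := t ^+ k; set E := _ * k`!%:R.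
move=> S_ge S_le ff_ge mk edges' nbig tk0 Nk0 tk1 N2.
have N0 : 0 < N by lra.
have lt_P : 16 * (ek * P) + (1 - ek) * E < P by lra.
(* Multiplying [lt_P] by [N] and inserting [N * P <= N * E + k ^ 2 * P] leaves
   [15 * ek * N * P < k ^ 2 * P], against [k ^ 2 < ek * N]. *)
have : 0 < N * (P - (16 * (ek * P) + (1 - ek) * E)).
  by rewrite mulr_gt0 // subr_gt0.
have : 0 <= (1 - ek) * (N * E + k%:R * k%:R * P - N * P).
  by rewrite mulr_ge0 ?subr_ge0.
have : 0 < (ek * N - k%:R ^+ 2) * P by rewrite mulr_gt0 // subr_gt0.
have : 0 <= ek * (k%:R ^+ 2 * P).
  by rewrite !mulr_ge0 ?sqr_ge0 // ltW.
have := mulr_gt0 (mulr_gt0 tk0 N0) Nk0.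
by lra.
Qed.

Theorem theorem4p1 (R : realType) (k : nat) (hk : (3 <= k)%N) (eps : R)
    (heps0 : 0 < eps) (heps1 : eps < 16 ^- k) :
  exists n0 : nat, forall (n : nat) (T : finType) (G : hypergraph T),
    (n0 < n)%N -> horder G = n -> huniform k G ->
    #|eset G|%:R > (1 - eps) * 'C(n, k)%:R ->
    (mcr k G)%:R >= (1 - 8 * eps `^ k%:R^-1) * n%:R.
Proof.
set t := eps `^ _.
have k_gt0 : (0 < k)%N by apply: leq_trans hk.
have tk : t ^+ k = eps.
  rewrite -powR_mulrn ?powR_ge0 // -powRrM mulVf ?powRr1 ?ltW //.
  by rewrite pnatr_eq0 -lt0n.
have t0 : 0 < t by rewrite powR_gt0.
have t1 : 16 * t < 1.
  rewrite mulrC -ltr_pdivlMr // div1r -(ltr_pXn2r k_gt0) ?nnegrE ?invr_ge0 ?ltW //.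
  by rewrite tk exprVn.
(* The bound yields [k ^ 2 < eps * n]; the successor ensures [n >= 2]. *)
exists (Num.bound (k%:R ^+ 2 / t ^+ k)).+1 => n T G n_gt nE unifG.
rewrite -tk => edges; rewrite -nE in n_gt edges *.
have nbig : k%:R ^+ 2 < t ^+ k * (horder G)%:R.
  rewrite mulrC -ltr_pdivrMr ?exprn_gt0 //.
  have /archi_boundP/lt_trans : 0 <= k%:R ^+ 2 / t ^+ k.
    by rewrite divr_ge0 ?sqr_ge0 // exprn_ge0 // ltW.
  by apply; rewrite ltr_nat; apply: ltn_trans n_gt.
rewrite /mcr.
apply: (big_ind (fun x : nat => (1 - 8 * t) * (horder G)%:R <= x%:R :> R)).
(* The default value [horder G] of the minimum satisfies the bound as [1 - 8 * t <= 1]. *)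
- by rewrite ler_piMl //; lra.
- by move=> x y ? ?; rewrite /minn; case: ifP.
- move=> chi _; apply: mc_almost_complete => //.
  by apply: leq_trans n_gt.
Qed.
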